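(* Let $\lambda>1$, $t_0\ge 1$, and let $q:[t_0,+\infty)\to[0,+\infty)$ be a continuous function whose zeros (if any) are isolated. Assume that $$\lambda\int_{t_0}^{+\infty}t\,q(t)\,dt<1 .$$ Then there exists $p>1$ such that, for all $c\in(0,1]$, the equation $$x''+q(t)x^{\lambda}=0,\qquad t\ge t_0,$$ has at least one solution $x(t)$ defined in $[t_0,+\infty)$ with the property that $$\frac{c}{p}\le x(t)\le c,\qquad t\ge t_0 ,$$ and such that $x(t)=c+o(1)$ and $x'(t)=o(t^{-1})$ as $t\to+\infty$.
   Context: For real $x$, $x^{\lambda}$ means $|x|^{\lambda-1}x$. *)

(* Defs.v *)
From HB Require Import structures.
From mathcomp Require Import all_boot all_order all_algebra.
From mathcomp Require Import all_classical all_reals all_analysis.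

Set Implicit Arguments.
Unset Strict Implicit.
Unset Printing Implicit Defensive.

Import Order.TTheory GRing.Theory Num.Theory.
Import numFieldNormedType.Exports.

Local Open Scope classical_set_scope.
Local Open Scope ring_scope.

(* The odd power |x|^(a-1) x; it differs from the library's x `^ a, which is
   not odd in x. *)
Definition odd_powR (R : realType) (x a : R) : R := `|x| `^ (a - 1) * x.

(* Difference quotients are restricted to D, so that for D = `[t0, +oo[ the
   derivative at t0 is the right derivative, and the values of f outside D are
   irrelevant. *)
Definition has_derivative_on (R : realType) (D : set R) (f f' : R -> R) : Prop :=
  forall t, D t ->
    (fun s => (f s - f t) / (s - t)) @ within D (t^') --> f' t.

(* x solves x'' + q(t) x^lambda = 0 on D, with x1 its first derivative on D. *)
Definition solves_emden_fowler (R : realType) (lambda : R) (q : R -> R)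
    (D : set R) (x x1 : R -> R) : Prop :=
  exists x2 : R -> R,
    [/\ has_derivative_on D x x1,
        has_derivative_on D x1 x2
      & forall t, D t -> x2 t + q t * odd_powR (x t) lambda = 0].

(* Lets the Landau notations range over the filter of neighborhoods of +oo. *)
Canonical pinfty_nbhs_filter_on (R : numFieldType) :=
  FilterType (pinfty_nbhs R) (@filter_filter _ _ proper_pinfty_nbhs).

(* Main.v *)
Require Import Defs.
From HB Require Import structures.
From mathcomp Require Import all_boot all_order all_algebra.
From mathcomp Require Import all_classical all_reals all_analysis.
From mathcomp Require Import measurable_realfun ring lra.

Set Implicit Arguments.
Unset Strict Implicit.
Unset Printing Implicit Defensive.

Import Order.TTheory GRing.Theory Num.Theory.
Import numFieldNormedType.Exports.

Local Open Scope classical_set_scope.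
Local Open Scope ring_scope.

(** Two integrations turn the equation, with the condition x -> c at infinity,
    into the fixed-point equation
      x(t) = c - \int_t^oo (s - t) h(s) ds,   h(s) = q(s) x(s)^lambda,
    because the second derivative of the integral is h. On the functions with
    values in [0, c], where c <= 1, the power x^lambda lies between 0 and x
    and is lambda-Lipschitz in x. As 0 <= s - t <= s for s >= t >= t0, the
    integral lies between 0 and c I, where I is the integral of s q(s), and
    the right-hand side is a contraction of ratio lambda I < 1 in the uniform
    distance. Its fixed point x ([emden_fowler_fixpoint]) satisfies
      x >= c (1 - I) >= c (1 - 1 / lambda),
    so p = lambda / (lambda - 1) serves for every c.

    The fixed point is sought among measurable functions, since these are
    closed under pointwise limits; its regularity comes afterwards. The
    integral is Lipschitz in t for measurable h, hence x is continuous, hence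
    h is, and then x' = \int_t^oo h and x'' = - h ([double_tail_derivative]
    and [tail_derivative]). Both c - x(t) and t x'(t) are nonnegative and at
    most \int_t^oo s h(s) ds, which tends to 0; these are the two asymptotic
    claims. *)

(** * A fixed point for uniform contractions *)

(** This is Banach's theorem for the uniform distance, on a set of functions
    closed under pointwise limits. The common bound M on distances gives the
    Cauchy estimate at once, since T^n x0 and T^(n+m) x0 are the images under
    T^n of two elements of P. *)
Lemma contraction_fixpoint (R : realType) (U : Type) (P : set (U -> R))
    (T : (U -> R) -> U -> R) (k M : R) (x0 : U -> R) :
  0 <= k -> k < 1 ->
  P x0 ->
  (forall x, P x -> P (T x)) ->
  (forall x y s, P x -> P y -> `|x s - y s| <= M) ->
  (forall x y m, P x -> P y -> (forall s, `|x s - y s| <= m) ->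
    forall s, `|T x s - T y s| <= k * m) ->
  (forall (f : nat -> U -> R) x, (forall n, P (f n)) ->
    (forall s, f ^~ s @ \oo --> x s) -> P x) ->
  exists2 x, P x & forall s, T x s = x s.
Proof.
move=> k0 k1 Px0 PT bnd contr closed.
pose y n := iter n T x0.
have Py n : P (y n) by elim: n => //= n; exact: PT.
have dist n m s : `|y n s - y (n + m)%N s| <= k ^+ n * M.
  elim: n s => [|n IHn] s; first by rewrite expr0 mul1r; exact: bnd.
  by rewrite exprS -mulrA addSn; apply: contr.
have geo0 : (fun n => k ^+ n * M) @ \oo --> (0 : R).
  rewrite -(mul0r M); apply: cvgM; last exact: cvg_cst.
  by apply: cvg_expr; rewrite ger0_norm.
have small e : 0 < e -> exists N, k ^+ N * M < e.
  move=> e0; have /cvgrPdist_lt/(_ e e0)[N _ hN] := geo0.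
  exists N; have /= := hN N (leqnn N).
  by rewrite sub0r normrN; exact: le_lt_trans (ler_norm _).
have cvgy s : cvgn (y ^~ s).
  apply/cauchy_cvgP/cauchy_exP => e e0.
  have [N hN] := small e e0.
  exists (y N s), N => // n /= Nn.
  by rewrite /ball/= -(subnKC Nn) (le_lt_trans (dist _ _ _)).
pose x s := limn (y ^~ s).
have yx s : y ^~ s @ \oo --> x s by exact: cvgy.
have Px : P x by exact: closed yx.
have close n s : `|y n s - x s| <= k ^+ n * M.
  have : (fun m => `|y n s - y m s|) @ \oo --> `|y n s - x s|.
    by apply: cvg_norm; apply: cvgB => //; exact: cvg_cst.
  move/cvgr_to_le; apply.
  by exists n => // m /= nm; rewrite -(subnKC nm).
exists x => // s; apply/eqP; rewrite -subr_eq0 -normr_le0.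
apply/ler_addgt0Pr => e e0; rewrite add0r.
have [N hN] := small (e / 2) (divr_gt0 e0 (ltr0Sn _ 1)).
have h1 : `|T x s - y N.+1 s| <= k * (k ^+ N * M).
  by apply: contr => // u; rewrite distrC.
have h2 := close N.+1 s; rewrite exprS -mulrA in h2.
have M0 : 0 <= k ^+ N * M by exact: le_trans (close N s).
have : k * (k ^+ N * M) <= k ^+ N * M by rewrite ler_piMl// ltW.
have := ler_distD (y N.+1 s) (T x s) (x s); lra.
Qed.

(** * Derivatives relative to a set *)

(** The hypothesis is the mean value inequality, with any bounds m and M of g
    between the two points. It is what monotonicity of an integral provides,
    and continuity of g squeezes the bounds to g t. *)
Lemma has_derivative_on_slope (R : realType) (D : set R) (f g : R -> R) :
  (forall t u m M, D t -> D u -> t < u ->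
    (forall s, t <= s <= u -> m <= g s <= M) ->
    m <= (f u - f t) / (u - t) <= M) ->
  is_interval D -> {within D, continuous g} -> has_derivative_on D f g.
Proof.
move=> slope Ditv /subspace_continuousP cg t Dt.
apply/cvgrPdist_le => e e0.
have /cvgrPdist_le/(_ e e0) := cg t Dt.
rewrite /within /= => /nbhs_ballP[d /= d0 gd].
rewrite near_withinE; near=> u => Du.
have ut : `|t - u| < d.
  near: u; apply: nbhs_dnbhs; exact: (nbhsx_ballx t d d0).
have neq : u != t by near: u; exact: nbhs_dnbhs_neq.
have gs s : (t <= s <= u) || (u <= s <= t) -> g t - e <= g s <= g t + e.
  move=> hs.
  have Ds : D s by case/orP: hs => [/(Ditv _ _ Dt Du)|/(Ditv _ _ Du Dt)].
  have : `|g t - g s| <= e.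
    apply: gd => //; rewrite /ball /=; apply: le_lt_trans ut.
    case/orP: hs => /andP[h1 h2].
      rewrite distrC [leRHS]distrC !ger0_norm ?subr_ge0// ?lerB//.
      by rewrite (le_trans h1).
    by rewrite !ger0_norm ?subr_ge0// ?lerB// (le_trans h1).
  by rewrite ler_norml; lra.
have : g t - e <= (f u - f t) / (u - t) <= g t + e.
  case/lt_total/orP: neq => [ut0|tu].
    rewrite -[f u - f t]opprB -[u - t]opprB invrN mulrNN.
    by apply: slope => // s hs; apply: gs; rewrite hs orbT.
  by apply: slope => // s hs; apply: gs; rewrite hs.
by rewrite ler_norml; lra.
Unshelve. all: by end_near. Qed.

Lemma has_derivative_on_continuous (R : realType) (D : set R) (f g : R -> R) :
  has_derivative_on D f g -> {within D, continuous f}.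
Proof.
move=> fg; apply/subspace_continuousP => t Dt.
have cD : (fun s : R => s - t) @ within D (t^') --> (0 : R).
  rewrite -(subrr t); apply: cvgB; last exact: cvg_cst.
  apply: cvg_within_filter; exact: nbhs_dnbhs.
have : (fun s => (f s - f t) / (s - t) * (s - t) + f t) @ within D (t^')
    --> f t.
  rewrite -[X in _ --> X]add0r -(mulr0 (g t)).
  apply: cvgD; last exact: cvg_cst.
  by apply: cvgM => //; exact: fg.
move/cvgrPdist_lt => cf; apply/cvgrPdist_lt => e e0.
have := cf e e0; rewrite !near_withinE.
apply: filterS => u hu Du; have [->|ut] := eqVneq u t.
  by rewrite subrr normr0.
by have := hu ut Du; rewrite divfK ?subr_eq0// subrK.
Qed.

Lemma has_derivative_on_cstB (R : realType) (D : set R) (c : R)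
    (f f' g g' : R -> R) :
  (forall t, D t -> g t = c - f t) -> (forall t, D t -> g' t = - f' t) ->
  has_derivative_on D f f' -> has_derivative_on D g g'.
Proof.
move=> gE g'E df t Dt; rewrite g'E//.
have /cvgrPdist_lt dft : (fun s => - ((f s - f t) / (s - t))) @ within D (t^')
    --> - f' t by apply: cvgN; exact: df.
apply/cvgrPdist_lt => e /dft; rewrite !near_withinE.
apply: filterS => s + st Ds => /(_ st Ds).
by rewrite -mulNr (gE s Ds) (gE t Dt); congr (`|_ - _ / _| < _); lra.
Qed.

Lemma lipschitz_within_continuous (R : realType) (D : set R) (f : R -> R)
    (K : R) :
  (forall s t, D s -> D t -> `|f s - f t| <= K * `|s - t|) ->
  {within D, continuous f}.
Proof.
move=> fK; apply/subspace_continuousP => t Dt.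
apply/cvgrPdist_lt => e e0; rewrite near_withinE.
have K1 : 0 < `|K| + 1 by rewrite ltr_wpDl.
apply/nbhs_ballP; exists (e / (`|K| + 1)); first exact: divr_gt0.
move=> s; rewrite /ball/= ltr_pdivlMr// => ts Ds.
apply: le_lt_trans ts; apply: le_trans (fK _ _ Dt Ds) _.
rewrite mulrC ler_wpM2l// (le_trans (ler_norm K))// lerDl//.
Qed.

(** * Integrals over rays *)

Lemma Rintegral_itvoc_bounds (R : realType) (f : R -> R) (t u m M : R) :
  t <= u ->
  lebesgue_measure.-integrable `]t, u] (EFin \o f) ->
  (forall s, t < s <= u -> m <= f s <= M) ->
  m * (u - t) <= \int[lebesgue_measure]_(s in `]t, u]) f s <= M * (u - t).
Proof.
move=> tu fi fmM.
have cstE (k : R) : \int[lebesgue_measure]_(s in `]t, u]) k = k * (u - t).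
  rewrite Rintegral_cst//= lebesgue_measure_itv/= lte_fin.
  case: ltgtP tu => // -> _.
  by rewrite subrr mulr0.
have csti (k : R) : lebesgue_measure.-integrable `]t, u] (EFin \o cst k).
  apply/integrableP; split; first exact/measurable_EFinP/measurable_cst.
  under eq_integral do rewrite /=.
  rewrite integral_cst//= lebesgue_measure_itv/=; case: ifP => _.
    by rewrite -EFinB -EFinM ltry.
  by rewrite mule0 ltry.
rewrite -!cstE; apply/andP; split.
  apply: le_Rintegral => //; first exact: csti.
  by move=> s /=; rewrite in_itv/= => /fmM/andP[].
apply: le_Rintegral => //; first exact: csti.
by move=> s /=; rewrite in_itv/= => /fmM/andP[].
Qed.

Lemma Rintegral_itv_split (R : realType) (f : R -> R) (t u : R) :
  t <= u ->
  lebesgue_measure.-integrable `]t, +oo[ (EFin \o f) ->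
  \int[lebesgue_measure]_(s in `]t, +oo[) f s =
    \int[lebesgue_measure]_(s in `]t, u]) f s +
    \int[lebesgue_measure]_(s in `]u, +oo[) f s.
Proof.
move=> tu fi; rewrite -(@Rintegral_itvB _ f (BRight t) +oo%O u) //.
by rewrite addrC subrK.
Qed.

Lemma Rintegral_tail_lt (R : realType) (f : R -> R) (a e : R) :
  (forall s, a <= s -> 0 <= f s) ->
  lebesgue_measure.-integrable `[a, +oo[ (EFin \o f) ->
  0 < e ->
  \forall t \near +oo, \int[lebesgue_measure]_(s in `]t, +oo[) f s < e.
Proof.
move=> f0 fi e0.
pose I (n : nat) :=
  (\int[lebesgue_measure]_(s in `[a, (a + n%:R)%R]) (f s)%:E)%E.
have sub (n : nat) : `[a, a + n%:R] `<=` `[a, +oo[.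
  by move=> s /=; rewrite !in_itv/= andbT => /andP[].
have fin n : lebesgue_measure.-integrable `[a, a + n%:R] (EFin \o f).
  exact: integrableS fi.
have cI : I @ \oo --> (\int[lebesgue_measure]_(s in `[a, +oo[) (f s)%:E)%E.
  rewrite itv_bndy_bigcup_BRight.
  apply: ge0_nondecreasing_set_cvg_integral => //.
  - apply/nondecreasing_seqP => n; rewrite subsetEset => s /=.
    rewrite !in_itv/= => /andP[-> /le_trans]; apply.
    by rewrite lerD2l ler_nat.
  - by move=> n; have /integrableP[] := fin n.
  - by move=> n s /=; rewrite in_itv/= lee_fin => /andP[/f0].
have {}cI : (fun n => \int[lebesgue_measure]_(s in `[a, a + n%:R]) f s) @ \oo
    --> \int[lebesgue_measure]_(s in `[a, +oo[) f s.
  by apply: fine_cvg; rewrite fineK//; exact: integrable_fin_num.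
have /cvgrPdist_lt/(_ e e0)[N _ hN] := cI.
exists (a + N%:R); split; first exact: num_real.
move=> t Nt; have at_ : a <= t by rewrite (le_trans _ (ltW Nt))// lerDl.
apply: le_lt_trans (hN N (leqnn N)); apply: le_trans (ler_norm _).
rewrite (@Rintegral_itvB _ f (BLeft a) +oo%O (a + N%:R))//; last first.
  by rewrite bnd_simp lerDl.
have fi' : lebesgue_measure.-integrable `](a + N%:R), +oo[ (EFin \o f).
  apply: integrableS fi => // s /=; rewrite !in_itv/= !andbT => /ltW.
  by apply: le_trans; rewrite lerDl.
rewrite (Rintegral_itv_split (ltW Nt))// lerDr.
apply: Rintegral_ge0 => s /=; rewrite in_itv/= => /andP[/ltW sa _].
by apply: f0; apply: le_trans sa; rewrite lerDl.
Qed.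

(** * Functions with a finite first moment *)

Definition finite_moment (R : realType) (a : R) (h : R -> R) : Prop :=
  [/\ forall s, a <= s -> 0 <= h s,
      measurable_fun `[a, +oo[ h
    & lebesgue_measure.-integrable `[a, +oo[ (fun s => (s * h s)%:E)].

Definition tail (R : realType) (h : R -> R) (t : R) : R :=
  \int[lebesgue_measure]_(s in `]t, +oo[) h s.

(** By Fubini this is the integral of [tail h] over the ray, that is, the
    double integral of h from t. *)
Definition double_tail (R : realType) (h : R -> R) (t : R) : R :=
  \int[lebesgue_measure]_(s in `]t, +oo[) ((s - t) * h s).

Definition first_moment (R : realType) (h : R -> R) (t : R) : R :=
  \int[lebesgue_measure]_(s in `]t, +oo[) (s * h s).

Lemma ray_sub (R : realType) (a t : R) : a <= t -> `]t, +oo[ `<=` `[a, +oo[.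
Proof. by move=> at_ s /=; rewrite !in_itv/= !andbT => /ltW/(le_trans at_). Qed.

(** Integrability on rays and the size of the tails are read off from this
    comparison with s h(s). *)
Lemma finite_moment_dominates (R : realType) (a t : R) (h w : R -> R) :
  finite_moment a h -> a <= t -> measurable_fun `]t, +oo[ w ->
  (forall s, t < s -> `|w s| <= s * h s) ->
  lebesgue_measure.-integrable `]t, +oo[ (EFin \o w) /\
  `|\int[lebesgue_measure]_(s in `]t, +oo[) w s| <= first_moment h t.
Proof.
move=> [h0 hm hi] at_ wm wh.
have hit : lebesgue_measure.-integrable `]t, +oo[ (fun s => (s * h s)%:E).
  by apply: integrableS hi => //; exact: ray_sub.
have wi : lebesgue_measure.-integrable `]t, +oo[ (EFin \o w).
  apply: (le_integrable _ _ _ hit) => //; first exact/measurable_EFinP.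
  move=> s /=; rewrite in_itv/= andbT lee_fin => ts.
  by rewrite (le_trans (wh s ts))// ler_norm.
split => //; apply: le_trans (le_normr_Rintegral _ wi) _ => //.
apply: le_Rintegral => //.
  have := integrable_norm wi; apply: eq_integrable => //.
by move=> s /=; rewrite in_itv/= andbT => /wh.
Qed.

Section tails.
Context (R : realType) (a : R) (h : R -> R).
Context (a1 : 1 <= a) (hM : finite_moment a h).

Let h0 s : a <= s -> 0 <= h s. Proof. by case: hM => + _ _; apply. Qed.

Let hm t : a <= t -> measurable_fun `]t, +oo[ h.
Proof.
by case: hM => _ hm _ /ray_sub sub; exact: measurable_funS hm.
Qed.

(** Here a >= 1 matters: it gives h(s) <= s h(s). *)
Lemma tail_integrable t : a <= t ->
  lebesgue_measure.-integrable `]t, +oo[ (EFin \o h).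
Proof.
move=> at_; apply: (finite_moment_dominates hM at_ (hm at_) _).1 => s ts.
have as_ : a <= s := le_trans at_ (ltW ts).
by rewrite ger0_norm ?h0// ler_peMl ?h0// (le_trans a1).
Qed.

Lemma double_tail_dominates (u t : R) : a <= t -> 0 <= u -> u <= t ->
  lebesgue_measure.-integrable `]t, +oo[ (EFin \o (fun s => (s - u) * h s)) /\
  `|\int[lebesgue_measure]_(s in `]t, +oo[) ((s - u) * h s)|
    <= first_moment h t.
Proof.
move=> at_ u0 ut; apply: (finite_moment_dominates hM at_).
  by apply: measurable_funM; [exact: measurable_funB|exact: hm].
move=> s ts; have as_ : a <= s := le_trans at_ (ltW ts).
have us : 0 <= s - u by rewrite subr_ge0 (le_trans ut)// ltW.
rewrite ger0_norm ?mulr_ge0 ?h0//.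
by apply: ler_wpM2r; [exact: h0|rewrite gerBl].
Qed.

Lemma tail_ge0 t : a <= t -> 0 <= tail h t.
Proof.
move=> at_; apply: Rintegral_ge0 => s /=; rewrite in_itv/= andbT => /ltW ts.
exact/h0/(le_trans at_).
Qed.

Lemma double_tail_ge0 t : a <= t -> 0 <= double_tail h t.
Proof.
move=> at_; apply: Rintegral_ge0 => s /=; rewrite in_itv/= andbT => /ltW ts.
by rewrite mulr_ge0 ?subr_ge0//; exact/h0/(le_trans at_).
Qed.

Lemma moment_ge0 t : a <= t -> 0 <= first_moment h t.
Proof.
move=> at_; apply: Rintegral_ge0 => s /=; rewrite in_itv/= andbT => /ltW ts.
have as_ := le_trans at_ ts.
by rewrite mulr_ge0 ?h0// (le_trans _ as_)// (le_trans _ a1).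
Qed.

Lemma double_tail_le_moment t : a <= t ->
  double_tail h t <= first_moment h t.
Proof.
move=> at_; apply: le_trans (ler_norm _) _.
have t0 : 0 <= t by rewrite (le_trans _ at_)// (le_trans _ a1).
exact: (double_tail_dominates at_ t0 (lexx t)).2.
Qed.

Lemma tail_le_moment t : a <= t -> t * tail h t <= first_moment h t.
Proof.
move=> at_; rewrite /tail -RintegralZl//; last exact: tail_integrable.
apply: le_trans (ler_norm _) _.
apply: (finite_moment_dominates hM at_ _ _).2.
  by apply: measurable_funM => //; exact: hm.
move=> s ts; have as_ : a <= s := le_trans at_ (ltW ts).
have t0 : 0 <= t by rewrite (le_trans _ at_)// (le_trans _ a1).
rewrite ger0_norm ?mulr_ge0 ?h0//.
by apply: ler_wpM2r; [exact: h0|exact: ltW].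
Qed.

Lemma moment_small e : 0 < e ->
  \forall t \near +oo, first_moment h t < e.
Proof.
move=> e0; case: hM => _ _ hi; apply: (Rintegral_tail_lt (a := a)) => // s as_.
by rewrite mulr_ge0 ?h0// (le_trans _ as_)// (le_trans _ a1).
Qed.

Lemma tail_split t u : a <= t -> t <= u ->
  tail h t = \int[lebesgue_measure]_(s in `]t, u]) h s + tail h u.
Proof.
by move=> at_ tu; apply: Rintegral_itv_split; [|exact: tail_integrable].
Qed.

Lemma tail_slope t u m M : a <= t -> t < u ->
  (forall s, t <= s <= u -> m <= h s <= M) ->
  - M <= (tail h u - tail h t) / (u - t) <= - m.
Proof.
move=> at_ tu hmM; have ut0 : 0 < u - t by rewrite subr_gt0.
rewrite ler_pdivlMr// ler_pdivrMr// (tail_split at_ (ltW tu)).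
have /andP[] : m * (u - t) <= \int[lebesgue_measure]_(s in `]t, u]) h s
    <= M * (u - t).
  apply: Rintegral_itvoc_bounds; first exact: ltW.
    apply: integrableS (tail_integrable at_) => //.
    by move=> s /=; rewrite !in_itv/= => /andP[->].
  by move=> s /andP[/ltW ts su]; apply: hmM; rewrite ts.
lra.
Qed.

(** The function [double_tail h] is convex, with - [tail h] as a subgradient.
    Between t and u it decreases by (u - t) (tail h u), the effect of moving
    the base point, plus the part of the integral over ]t, u], where
    s - t <= u - t. *)
Lemma double_tail_slope t u : a <= t -> t < u ->
  - tail h t <= (double_tail h u - double_tail h t) / (u - t) <= - tail h u.
Proof.
move=> at_ tu; have ut0 : 0 < u - t by rewrite subr_gt0.
have t0 : 0 <= t by rewrite (le_trans _ at_)// (le_trans _ a1).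
have au : a <= u := le_trans at_ (ltW tu).
have sub : `]t, u] `<=` `]t, +oo[.
  by move=> s /=; rewrite !in_itv/= => /andP[->].
have it := (double_tail_dominates at_ t0 (lexx t)).1.
have iu := (double_tail_dominates au t0 (ltW tu)).1.
have iuu := (double_tail_dominates au (le_trans t0 (ltW tu)) (lexx u)).1.
have itu : lebesgue_measure.-integrable `]t, u]
    (EFin \o (fun s => (s - t) * h s)) by exact: integrableS it.
have dtE : double_tail h t =
    \int[lebesgue_measure]_(s in `]t, u]) ((s - t) * h s) +
    ((u - t) * tail h u + double_tail h u).
  rewrite /double_tail (Rintegral_itv_split (ltW tu) it); congr (_ + _).
  apply/eqP; rewrite -subr_eq -RintegralB//.
  rewrite /tail -RintegralZl//; last exact: tail_integrable.
  by apply/eqP/eq_Rintegral => s _ /=; lra.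
have J0 : 0 <= \int[lebesgue_measure]_(s in `]t, u]) ((s - t) * h s).
  apply: Rintegral_ge0 => s /=; rewrite in_itv/= => /andP[/ltW ts _].
  by rewrite mulr_ge0 ?subr_ge0//; exact/h0/(le_trans at_).
have J1 : \int[lebesgue_measure]_(s in `]t, u]) ((s - t) * h s) <=
    (u - t) * (tail h t - tail h u).
  have htu : lebesgue_measure.-integrable `]t, u] (EFin \o h).
    by apply: integrableS (tail_integrable at_).
  rewrite (tail_split at_ (ltW tu)) addrK -RintegralZl//.
  apply: le_Rintegral => //; first exact: (integrableZl _ (u - t)) htu.
  move=> s /=; rewrite in_itv/= => /andP[/ltW ts su].
  apply: ler_wpM2r; last by rewrite lerB.
  exact/h0/(le_trans at_).
rewrite ler_pdivlMr// ler_pdivrMr//; move: J0 J1 dtE.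
move: (\int[_]_(s in _) _) => J J0 J1 ->.
by rewrite mulrBr in J1; rewrite !mulNr ![_ * (u - t)]mulrC; lra.
Qed.

Lemma tail_derivative : {within `[a, +oo[, continuous h} ->
  has_derivative_on `[a, +oo[ (tail h) (fun t => - h t).
Proof.
move=> hc; apply: has_derivative_on_slope.
- move=> t u m M /=; rewrite !in_itv/= !andbT => at_ _ tu hmM.
  rewrite -[m]opprK -[M]opprK; apply: tail_slope => // s /hmM; lra.
- exact: interval_is_interval.
- by move=> t; apply: cvgN; exact: hc.
Qed.

Lemma tail_le t u : a <= t -> t <= u -> tail h u <= tail h t.
Proof.
move=> at_ tu; rewrite (tail_split at_ tu) lerDr.
apply: Rintegral_ge0 => s /=; rewrite in_itv/= => /andP[/ltW ts _].
exact/h0/(le_trans at_).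
Qed.

Lemma moment_nonincreasing t u : a <= t -> t <= u ->
  first_moment h u <= first_moment h t.
Proof.
move=> at_ tu; have hi : lebesgue_measure.-integrable `]t, +oo[
    (EFin \o (fun s => s * h s)).
  by case: hM => _ _; apply: integrableS => //; exact: ray_sub.
rewrite /first_moment (Rintegral_itv_split tu hi) lerDr.
apply: Rintegral_ge0 => s /=; rewrite in_itv/= => /andP[/ltW ts _].
have as_ := le_trans at_ ts.
by rewrite mulr_ge0 ?h0// (le_trans _ as_)// (le_trans _ a1).
Qed.

(** This gives the continuity of a solution of the integral equation before
    the continuity of its second derivative is known. *)
Lemma double_tail_lipschitz t u : a <= t -> a <= u ->
  `|double_tail h u - double_tail h t| <= tail h a * `|u - t|.
Proof.
wlog tu : t u / t < u => [hw at_ au|].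
  have [tu|ut|->] := ltgtP t u; first exact: hw.
    by rewrite distrC [`|u - t|]distrC; exact: hw.
  by rewrite !subrr !normr0 mulr0.
move=> at_ au; have ut0 : 0 < u - t by rewrite subr_gt0.
have /andP[] := double_tail_slope at_ tu.
rewrite ler_pdivlMr// ler_pdivrMr// (gtr0_norm ut0) !mulNr => h1 h2.
have h3 : tail h t * (u - t) <= tail h a * (u - t).
  by rewrite ler_wpM2r ?tail_le// ltW.
have h4 : 0 <= tail h u * (u - t) by rewrite mulr_ge0 ?tail_ge0// ltW.
by rewrite ler_norml; apply/andP; split; lra.
Qed.

Lemma double_tail_le t u : a <= t -> t <= u ->
  double_tail h u <= double_tail h t.
Proof.
move=> at_; rewrite le_eqVlt => /predU1P[<-//|tu].
have /andP[_] := double_tail_slope at_ tu.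
rewrite ler_pdivrMr ?subr_gt0// => /le_trans le_u.
rewrite -subr_le0; apply: le_u; rewrite mulNr oppr_le0 mulr_ge0//.
  exact/tail_ge0/(le_trans at_)/ltW.
by rewrite subr_ge0 ltW.
Qed.

Lemma double_tail_derivative : {within `[a, +oo[, continuous h} ->
  has_derivative_on `[a, +oo[ (double_tail h) (fun t => - tail h t).
Proof.
move=> hc; apply: has_derivative_on_slope.
- move=> t u m M /=; rewrite !in_itv/= !andbT => at_ _ tu hmM.
  have /andP[+ +] := double_tail_slope at_ tu.
  have := hmM t; rewrite lexx ltW// => /(_ isT)/andP[mt _].
  have := hmM u; rewrite lexx ltW// => /(_ isT)/andP[_ uM].
  by move=> h1 h2; rewrite (le_trans mt)// (le_trans h2).
- exact: interval_is_interval.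
- move=> t; apply: cvgN.
  exact: (has_derivative_on_continuous (tail_derivative hc)).
Qed.

End tails.

Lemma finite_momentZ (R : realType) (a k : R) (h : R -> R) :
  0 <= k -> finite_moment a h -> finite_moment a (fun s => k * h s).
Proof.
move=> k0 [h0 hm hi]; split; first by move=> s /h0; exact: mulr_ge0.
  exact: measurable_funM.
have : lebesgue_measure.-integrable `[a, +oo[
    (fun s => k%:E * (s * h s)%:E)%E by exact: integrableZl.
apply: eq_integrable => // s _.
by rewrite /= -EFinM mulrCA.
Qed.

Lemma momentZ (R : realType) (a k t : R) (h : R -> R) :
  finite_moment a h -> a <= t ->
  first_moment (fun s => k * h s) t = k * first_moment h t.
Proof.
move=> [_ _ hi] at_; rewrite /first_moment -RintegralZl//.
  by apply: eq_Rintegral => s _; rewrite mulrCA.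
by apply: integrableS hi => //; exact: ray_sub.
Qed.

Lemma finite_moment_le (R : realType) (a : R) (g h : R -> R) :
  1 <= a -> finite_moment a h -> measurable_fun `[a, +oo[ g ->
  (forall s, a <= s -> 0 <= g s <= h s) ->
  finite_moment a g /\ forall t, a <= t -> first_moment g t <= first_moment h t.
Proof.
move=> a1 hM gm gh.
have sg s : a <= s -> `|s * g s| <= s * h s.
  move=> as_; have s0 : 0 <= s by rewrite (le_trans _ as_)// (le_trans _ a1).
  have /andP[g0 gle] := gh s as_.
  by rewrite ger0_norm ?mulr_ge0// ler_wpM2l.
have sgm : measurable_fun `[a, +oo[ (fun s => s * g s).
  by apply: measurable_funM.
split; first split => //.
- by move=> s /gh/andP[].
- case: hM => _ _ hi; apply: (le_integrable _ _ _ hi) => //.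
    exact/measurable_EFinP.
  move=> s /=; rewrite in_itv/= andbT lee_fin => as_.
  by rewrite (le_trans (sg s as_))// ler_norm.
- move=> t at_; apply: le_trans (ler_norm _) _.
  apply: (finite_moment_dominates hM at_ _ _).2.
    by apply: measurable_funS sgm => //; exact: ray_sub.
  by move=> s ts; apply: sg; rewrite (le_trans at_)// ltW.
Qed.

(** * The power nonlinearity on the unit interval *)

Lemma powR_le1 (R : realType) (r x : R) : 0 <= r -> 0 <= x <= 1 -> x `^ r <= 1.
Proof.
move=> r0 /andP[x0 x1].
suff : x `^ r <= 1 `^ r by rewrite powR1.
by apply: ge0_ler_powR; rewrite ?nnegrE.
Qed.

Lemma odd_powRE (R : realType) (l x : R) : 1 < l -> 0 <= x ->
  odd_powR x l = x `^ l.
Proof.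
move=> l1 x0; rewrite /odd_powR ger0_norm// mulrC mulr_powRB1//.
exact: lt_trans l1.
Qed.

Lemma odd_powR_unit_itv (R : realType) (l x : R) : 1 < l -> 0 <= x <= 1 ->
  0 <= odd_powR x l <= x.
Proof.
move=> l1 /andP[x0 x1]; rewrite /odd_powR mulr_ge0 ?powR_ge0//=.
rewrite ler_piMl// powR_le1//; first by rewrite subr_ge0 ltW.
by rewrite ger0_norm// x0.
Qed.

(** Young's inequality for the conjugate exponents l and l / (l - 1), applied
    to y and x^(l-1), reads l y x^(l-1) <= y^l + (l - 1) x^l, that is,
    x^l - y^l <= l x^(l-1) (x - y). Since x^(l-1) <= 1, this gives the Lipschitz
    constant l. *)
Lemma odd_powR_lipschitz (R : realType) (l x y : R) : 1 < l ->
  0 <= x <= 1 -> 0 <= y <= 1 ->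
  `|odd_powR x l - odd_powR y l| <= l * `|x - y|.
Proof.
move=> l1; have l0 : 0 < l by exact: lt_trans l1.
wlog yx : x y / y <= x => [hw x01 y01|/andP[x0 x1] /andP[y0 y1]].
  have [yx|/ltW xy] := leP y x; first exact: hw.
  by rewrite distrC [`|x - y|]distrC; exact: hw.
have l10 : 0 < l - 1 by rewrite subr_gt0.
rewrite !odd_powRE// !ger0_norm ?subr_ge0//; last first.
  by apply: ge0_ler_powR => //; exact: ltW.
have b0 : 0 <= x `^ (l - 1) by exact: powR_ge0.
have b1 : x `^ (l - 1) <= 1 by rewrite powR_le1 ?(ltW l10)// x0.
have conj : l^-1 + (l / (l - 1))^-1 = 1 by field; rewrite !gt_eqF.
have young := conjugate_powR y0 b0 l0 (divr_gt0 l0 l10) conj.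
rewrite -powRrM mulrCA mulfV ?gt_eqF// mulr1 in young.
have xE : x * x `^ (l - 1) = x `^ l by exact: mulr_powRB1.
have {}young : l * (y * x `^ (l - 1)) <= y `^ l + (l - 1) * x `^ l.
  rewrite -ler_pdivlMl//; apply: le_trans young _.
  by rewrite le_eqVlt; apply/orP; left; apply/eqP; field; rewrite !gt_eqF.
have : l * (x `^ (l - 1) * (x - y)) <= l * (x - y).
  by rewrite ler_wpM2l ?(ltW l0)// ler_piMl// subr_ge0.
rewrite -xE in young *; nra.
Qed.

Lemma measurable_odd_powR (R : realType) (l : R) :
  measurable_fun [set: R] (fun x => odd_powR x l).
Proof.
apply: measurable_funM => //.
apply: (@measurableT_comp _ _ _ _ _ _ (fun z => powR z (l - 1))).
  exact: measurable_powR.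
exact: normr_measurable.
Qed.

(** * The integral equation *)

Definition forcing (R : realType) (lambda : R) (q x : R -> R) (s : R) : R :=
  q s * odd_powR (x s) lambda.

(** Since x^lambda <= x <= c, the forcing is at most c q; the factor
    c is what makes the constant p of the theorem independent of c. *)
Lemma forcing_finite_moment (R : realType) (lambda t0 c : R) (q x : R -> R) :
  1 < lambda -> 1 <= t0 -> 0 <= c -> c <= 1 -> finite_moment t0 q ->
  measurable_fun setT x -> (forall s, 0 <= x s <= c) ->
  finite_moment t0 (forcing lambda q x) /\
  forall t, t0 <= t ->
    first_moment (forcing lambda q x) t <= c * first_moment q t.
Proof.
move=> lambda_gt1 t0_ge1 c0 c1 qM xm x0c.
have [|||fM fmo] := @finite_moment_le R t0 (forcing lambda q x)
  (fun s => c * q s) t0_ge1.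
- exact: finite_momentZ c0 qM.
- apply: measurable_funM; first by case: qM.
  apply: (measurableT_comp (@measurable_odd_powR R lambda)).
  exact: measurable_funTS.
- move=> s ts; have q0 : 0 <= q s by case: qM => + _ _; apply.
  have /andP[x0 xc] := x0c s.
  have /andP[p0 px] : 0 <= odd_powR (x s) lambda <= x s.
    by apply: odd_powR_unit_itv => //; rewrite x0 (le_trans xc).
  by rewrite /forcing mulr_ge0//= [leRHS]mulrC ler_wpM2l// (le_trans px).
- by split=> // t tt; apply: le_trans (fmo t tt) _; rewrite (momentZ _ qM).
Qed.

(** The contraction acts on measurable functions with values in [0, c]. Its
    image consists of monotone functions, which are therefore measurable
    again. *)
Lemma emden_fowler_fixpoint (R : realType) (lambda t0 c : R) (q : R -> R) :
  1 < lambda -> 1 <= t0 -> 0 < c -> c <= 1 ->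
  finite_moment t0 q -> lambda * first_moment q t0 < 1 ->
  exists x : R -> R,
    [/\ measurable_fun setT x, forall s, 0 <= x s <= c
      & forall t, t0 <= t ->
          x t = c - double_tail (forcing lambda q x) t].
Proof.
move=> lambda_gt1 t0_ge1 c0 c1 qM qI.
have l0 : 0 < lambda by exact: lt_trans lambda_gt1.
have I0 : 0 <= first_moment q t0 by exact: (moment_ge0 t0_ge1 qM (lexx t0)).
have I1 : first_moment q t0 <= 1.
  by apply: le_trans (ltW qI); rewrite ler_peMl// ltW.
pose P (x : R -> R) := measurable_fun setT x /\ forall s, 0 <= x s <= c.
pose src := forcing lambda q.
(* Functions live on the whole line; stopping t at t0 keeps the bounds there. *)
pose cl t := Order.max t t0.
have t0cl t : t0 <= cl t by rewrite /cl le_max lexx orbT.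
pose T (x : R -> R) t := c - double_tail (src x) (cl t).
have x01 x s : P x -> 0 <= x s <= 1.
  by move=> [_ /(_ s)/andP[-> /le_trans]]; apply.
have srcM x : P x -> finite_moment t0 (src x) /\
    forall t, t0 <= t -> first_moment (src x) t <= c * first_moment q t0.
  move=> [xm x0c].
  have [sM smo] :=
    forcing_finite_moment lambda_gt1 t0_ge1 (ltW c0) c1 qM xm x0c.
  split=> // t tt; apply: le_trans (smo t tt) _.
  rewrite ler_wpM2l ?(ltW c0)//.
  exact: (moment_nonincreasing t0_ge1 qM (lexx t0)).
have TP x : P x -> P (T x).
  move=> Px; have [sM smo] := srcM x Px; split.
    apply: nondecreasing_measurable => // s t st.
    rewrite lerD2l lerN2; apply: double_tail_le t0_ge1 sM _ _ (t0cl s) _.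
    by rewrite /cl ge_max !le_max st lexx orbT.
  move=> s; have d0 := double_tail_ge0 sM (t0cl s).
  have d1 := double_tail_le_moment t0_ge1 sM (t0cl s).
  have d2 := smo _ (t0cl s).
  have d3 : c * first_moment q t0 <= c by rewrite ler_piMr// ltW.
  by rewrite /T; apply/andP; split; lra.
have Tcontr x y (m : R) : P x -> P y -> (forall s, `|x s - y s| <= m) ->
    forall s, `|T x s - T y s| <= lambda * first_moment q t0 * m.
  move=> Px Py xym s; set u := cl s; have t0u : t0 <= u := t0cl s.
  have m0 : 0 <= m by exact: le_trans (xym 0).
  have u0 : 0 <= u by rewrite (le_trans _ t0u)// (le_trans _ t0_ge1).
  have [sxM _] := srcM x Px; have [syM _] := srcM y Py.
  have ix := (double_tail_dominates sxM t0u u0 (lexx u)).1.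
  have iy := (double_tail_dominates syM t0u u0 (lexx u)).1.
  have -> : T x s - T y s = \int[lebesgue_measure]_(r in `]u, +oo[)
      ((r - u) * src y r - (r - u) * src x r).
    by rewrite RintegralB// /T -/u /double_tail; lra.
  have kM : finite_moment t0 (fun r => (lambda * m) * q r).
    by apply: finite_momentZ => //; rewrite mulr_ge0// ltW.
  have [|r ur|] := finite_moment_dominates kM t0u (w := fun r =>
      (r - u) * src y r - (r - u) * src x r).
  - have mu_src z : P z ->
        measurable_fun `]u, +oo[ (fun r => (r - u) * src z r).
      move=> Pz; apply: measurable_funM; first exact: measurable_funB.
      have [[_ zm _] _] := srcM z Pz.
      by apply: measurable_funS zm => //; exact: ray_sub.
    by apply: measurable_funB; exact: mu_src.
  - have q0 : 0 <= q r.
      by case: qM => + _ _; apply; rewrite (le_trans t0u)// ltW.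
    have ru : 0 <= r - u by rewrite subr_ge0 ltW.
    rewrite -mulrBr normrM ger0_norm// /src /forcing.
    rewrite -mulrBr normrM (ger0_norm q0).
    have lip : `|odd_powR (y r) lambda - odd_powR (x r) lambda| <= lambda * m.
      have := odd_powR_lipschitz lambda_gt1 (x01 _ r Py) (x01 _ r Px).
      move/le_trans; apply.
      by rewrite distrC ler_wpM2l// ltW.
    rewrite ler_pM ?mulr_ge0//; first by rewrite gerBl.
    by rewrite mulrC ler_wpM2r.
  - move=> _ /le_trans; apply.
    rewrite (momentZ _ qM)// -!mulrA [m * _]mulrC ler_wpM2l ?(ltW l0)//.
    by rewrite ler_wpM2r//; exact: (moment_nonincreasing t0_ge1 qM (lexx t0)).
have [|||||||x [xm x0c] Tx] := @contraction_fixpoint R R P T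
    (lambda * first_moment q t0) c (cst c).
- by rewrite mulr_ge0// ltW.
- exact: qI.
- by split; [exact: measurable_cst|move=> s; rewrite lexx ltW].
- exact: TP.
- move=> x y s [_ /(_ s) xs] [_ /(_ s) ys].
  by rewrite ler_norml; apply/andP; split; lra.
- exact: Tcontr.
- move=> f x fP fx; split.
    by apply: (measurable_fun_cvg (h := f)) => // n; have [] := fP n.
  move=> s; apply/andP; split.
    by apply: cvgr_to_ge (fx s) _; near=> n; have [_ /(_ s)/andP[]] := fP n.
  by apply: cvgr_to_le (fx s) _; near=> n; have [_ /(_ s)/andP[]] := fP n.
exists x; split => // t tt; rewrite -[LHS]Tx /T /cl.
by rewrite (max_idPl _).
Unshelve. all: by end_near. Qed.

(** * Existence of the solution *)

Theorem theorem5 (R : realType) (lambda t0 : R) (q : R -> R)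
    (lambda_gt1 : 1 < lambda) (t0_ge1 : 1 <= t0)
    (q_ge0 : forall t, t0 <= t -> 0 <= q t)
    (q_cont : {within `[t0, +oo[, continuous q})
    (q_zeros : let Z := [set t | t0 <= t /\ q t = 0] in Z `<=` isolated Z)
    (q_int : (lambda%:E *
      \int[lebesgue_measure]_(t in `[t0, +oo[) (t * q t)%:E < 1)%E) :
  exists p : R, 1 < p /\
    forall c : R, 0 < c -> c <= 1 ->
      exists x x1 : R -> R,
        [/\ solves_emden_fowler lambda q `[t0, +oo[ x x1,
            forall t, t0 <= t -> c / p <= x t <= c,
            x = cst c +o_ (+oo_R) (cst (1 : R))
          & x1 =o_ (+oo_R) (fun t => t^-1)].
Proof.
have l0 : 0 < lambda by exact: lt_trans lambda_gt1.
have qm : measurable_fun `[t0, +oo[ q.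
  exact: subspace_continuous_measurable_fun.
have tqm : measurable_fun `[t0, +oo[ (fun t => t * q t).
  exact: measurable_funM.
have tq0 t : t0 <= t -> 0 <= t * q t.
  by move=> tt; rewrite mulr_ge0 ?q_ge0// (le_trans _ tt)// (le_trans _ t0_ge1).
(* lambda times an infinite integral would not be less than 1. *)
have [J JE] : exists J : R,
    (\int[lebesgue_measure]_(t in `[t0, +oo[) (t * q t)%:E = J%:E)%E.
  have : (0 <= \int[lebesgue_measure]_(t in `[t0, +oo[) (t * q t)%:E)%E.
    apply: integral_ge0 => t /=; rewrite in_itv/= andbT lee_fin; exact: tq0.
  move: q_int; case: (integral _ _ _) => [J _ _||//].
    by exists J.
  by rewrite gt0_muley// lte_fin.
have qM : finite_moment t0 q.
  split => //; apply/integrableP; split; first exact/measurable_EFinP.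
  rewrite (_ : (\int[_]_(x in _) _)%E = J%:E) ?ltry// -JE.
  apply: eq_integral => t; rewrite inE/= in_itv/= andbT => tt.
  by rewrite ger0_norm// tq0.
have qI : lambda * first_moment q t0 < 1.
  rewrite -lte_fin EFinM; apply: le_lt_trans q_int.
  rewrite le_eqVlt; apply/orP; left; apply/eqP; congr (_ * _)%E.
  rewrite /first_moment Rintegral_itv_obnd_cbnd; last first.
    by case: qM => _ _; apply: integrableS => //; exact: ray_sub.
  by rewrite /Rintegral JE.
have l10 : 0 < lambda - 1 by rewrite subr_gt0.
exists (lambda / (lambda - 1)); split.
  by rewrite ltr_pdivlMr// mul1r ltrBlDr ltrDl.
move=> c c0 c1.
have [x [xm x0c xE]] :=
  emden_fowler_fixpoint lambda_gt1 t0_ge1 c0 c1 qM qI.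
set h := forcing lambda q x in xE.
have x01 s : 0 <= x s <= 1.
  by have /andP[-> /le_trans] := x0c s; apply.
have [hM hmo] :=
  forcing_finite_moment lambda_gt1 t0_ge1 (ltW c0) c1 qM xm x0c.
rewrite -/h in hM hmo.
(* The integral equation makes x Lipschitz, and h is then continuous with q. *)
have xc : {within `[t0, +oo[, continuous (fun s => odd_powR (x s) lambda)}.
  apply: (@lipschitz_within_continuous R _ _ (lambda * tail h t0)).
  move=> u s /=; rewrite !in_itv/= !andbT => uu ss.
  apply: le_trans (odd_powR_lipschitz lambda_gt1 (x01 u) (x01 s)) _.
  rewrite -mulrA ler_wpM2l ?(ltW l0)// (xE u uu) (xE s ss).
  have -> (y z : R) : c - y - (c - z) = z - y by ring.
  rewrite distrC; exact: (double_tail_lipschitz t0_ge1 hM ss uu).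
have hc : {within `[t0, +oo[, continuous h}.
  by move=> t; apply: cvgM; [exact: q_cont|exact: xc].
exists x, (tail h); split.
- exists (fun t => - h t); split.
  + apply: has_derivative_on_cstB (double_tail_derivative t0_ge1 hM hc).
      move=> t /=; rewrite in_itv/= andbT => tt. exact: xE.
    by move=> t _; rewrite opprK.
  + exact: (tail_derivative t0_ge1 hM hc).
  + by move=> t _; rewrite /h /forcing addNr.
- move=> t tt; have /andP[_ ->] := x0c t; rewrite andbT (xE t tt).
  have d1 := double_tail_le_moment t0_ge1 hM tt.
  have d2 := hmo t tt.
  have d3 : first_moment q t <= first_moment q t0.
    exact: (moment_nonincreasing t0_ge1 qM (lexx t0) tt).
  have d4 : first_moment q t <= lambda^-1.
    by apply: le_trans d3 _; rewrite -[lambda^-1]mul1r ler_pdivlMr// mulrC ltW.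
  have d5 : c * first_moment q t <= c * lambda^-1 by rewrite ler_wpM2l// ltW.
  have -> : c / (lambda / (lambda - 1)) = c - c * lambda^-1.
    by field; rewrite !gt_eqF.
  lra.
- apply/eqaddoP => e e0; near=> t.
  have tt : t0 <= t by near: t; apply: nbhs_pinfty_ge; exact: num_real.
  rewrite !fctE (xE t tt) normr1 mulr1 addrC addKr normrN ger0_norm.
    apply: le_trans (double_tail_le_moment t0_ge1 hM tt) _.
    by apply: ltW; near: t; exact: (moment_small t0_ge1 hM e0).
  exact: (double_tail_ge0 hM tt).
- apply/eqoP => e e0; near=> t.
  have tt : t0 <= t by near: t; apply: nbhs_pinfty_ge; exact: num_real.
  have tp : 0 < t by rewrite (lt_le_trans _ tt)// (lt_le_trans _ t0_ge1).
  rewrite ger0_norm ?(tail_ge0 hM tt)// ger0_norm ?invr_ge0 ?(ltW tp)//.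
  rewrite ler_pdivlMr// mulrC.
  apply: le_trans (tail_le_moment t0_ge1 hM tt) _.
  by apply: ltW; near: t; exact: (moment_small t0_ge1 hM e0).
Unshelve. all: by end_near. Qed.
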